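(* Let $S$ be a set of $n$ sites with weights $w_1,\dots,w_n$ of minimum $1$ and total weight $W=\sum_i w_i$, placed at independent uniformly random positions on the $d$-dimensional torus $\mathbb T^d$ equipped with a $\mathfrak p$-norm. For every fixed $k$, the expected number of non-empty regions of the weighted order-$k$ Voronoi diagram of $S$ is $O(W)$ (with the constant depending only on $k,d,\mathfrak p$). The same holds for sites placed uniformly at random in the hypercube $[0,1]^d$ with the $\mathfrak p$-norm distance.
   Context: $\mathbb T^d$ is $[0,1]^d$ with opposite faces identified ($d$ a fixed constant), with distance $\mathrm{dist}(p,q)=\left(\sum_{i=1}^d|p_i-q_i|_\circ^{\mathfrak p}\right)^{1/\mathfrak p}$ (and $\max_i|p_i-q_i|_\circ$ for $\mathfrak p=\infty$), where $|a-b|_\circ=\min\{|a-b|,1-|a-b|\}$ and $\mathfrak p\in\mathbb N^+\cup\{\infty\}$ is fixed. For sites $s_1,\dots,s_n$ with weights $w_i$, let $\omega_i=w_i^{1/d}$; the weighted distance from a point $p$ to $s_i$ is $\mathrm{dist}(s_i,p)/\omega_i$. For $A\subseteq S$ with $|A|=k$, the order-$k$ Voronoi region of $A$ is the set of points $p$ for which there exists $r$ with $\mathrm{dist}(s_i,p)\le\omega_i r$ for all $s_i\in A$ and $\mathrm{dist}(s_i,p)>\omega_i r$ for all $s_i\notin A$. The weighted order-$k$ Voronoi diagram is the collection of non-empty order-$k$ regions. *)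

(* Defs.v *)
From HB Require Import structures.
From mathcomp Require Import all_boot all_order all_algebra.
From mathcomp Require Import all_classical all_reals all_analysis.
Set Implicit Arguments. Unset Strict Implicit. Unset Printing Implicit Defensive.
Import Order.TTheory GRing.Theory Num.Theory.
Local Open Scope classical_set_scope.
Local Open Scope ring_scope.

Section Voronoi.
Variable R : realType.

Definition circ_abs (a b : R) : R := Num.min `|a - b| (1 - `|a - b|).

(* coordinate-wise p-norm distance built from a 1-d distance f;
   p = Some q is the q-norm (q >= 1), p = None is the max-norm *)
Definition pdist (p : option nat) (d : nat) (f : R -> R -> R)
  (x y : 'I_d -> R) : R :=
  match p with
  | Some q => (\sum_(i < d) (f (x i) (y i)) ^+ q) `^ (q%:R^-1)
  | None => \big[Num.max/0]_(i < d) f (x i) (y i)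
  end.

Definition torus_dist (p : option nat) (d : nat) := @pdist p d circ_abs.
Definition cube_dist (p : option nat) (d : nat) := @pdist p d (fun a b : R => `|a - b|).

(* the order-k Voronoi region of A (w.r.t. sites s, multiplicative
   weights om = w^(1/d), distance dist, ambient point set dom) is non-empty *)
Definition region_nonempty (n d : nat)
  (dist : ('I_d -> R) -> ('I_d -> R) -> R) (dom : set ('I_d -> R))
  (s : 'I_n -> 'I_d -> R) (om : 'I_n -> R) (A : {set 'I_n}) : Prop :=
  exists x, dom x /\ exists r : R,
    (forall i, i \in A -> dist (s i) x <= om i * r) /\
    (forall i, i \notin A -> om i * r < dist (s i) x).

Definition num_regions (n d k : nat)
  (dist : ('I_d -> R) -> ('I_d -> R) -> R) (dom : set ('I_d -> R))
  (s : 'I_n -> 'I_d -> R) (om : 'I_n -> R) : nat :=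
  \sum_(A : {set 'I_n} | #|A| == k) `[< region_nonempty dist dom s om A >].

Definition torus_points d : set ('I_d -> R) :=
  [set x | forall j, 0 <= x j < 1].
Definition cube_points d : set ('I_d -> R) :=
  [set x | forall j, 0 <= x j <= 1].

Definition vcons (x : R) (v : nat -> R) : nat -> R :=
  fun j => if j is j'.+1 then v j' else x.

(* expectation of f(U_0,...,U_{m-1}) for i.i.d. uniform U_j on [0,1],
   as an iterated Lebesgue integral (equal to the product-measure
   integral by Fubini-Tonelli for measurable nonnegative f) *)
Fixpoint unif_expect (m : nat) (f : (nat -> R) -> \bar R) : \bar R :=
  match m with
  | 0 => f (fun _ => 0)
  | m'.+1 => (\int[@lebesgue_measure R]_(x in `[(0:R)%R, (1:R)%R]) unif_expect m' (fun v => f (vcons x v)))%E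
  end.

Definition sites_of (n d : nat) (v : nat -> R) : 'I_n -> 'I_d -> R :=
  fun i j => v (i * d + j)%N.

Definition omega (d n : nat) (w : 'I_n -> R) : 'I_n -> R :=
  fun i => w i `^ (d%:R^-1).

Definition expected_regions (n d k : nat)
  (dist : ('I_d -> R) -> ('I_d -> R) -> R) (dom : set ('I_d -> R))
  (w : 'I_n -> R) : \bar R :=
  unif_expect (n * d) (fun v =>
    ((num_regions k dist dom (@sites_of n d v) (omega d w))%:R)%:E).

End Voronoi.

(* Main.v *)
(** Cut the unit cube into M^d cells with M^d of order W and bound, for a cell
    with corner c, the expected number of regions meeting it by a constant.
    If A is the region of a point x of the cell, let r be the least admissible
    radius; it is attained at some i0 in A. Moving from x to c changes distances
    by at most 1/M, so, on a dyadic scale rho ~ r, all sites of A lie in boxes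
    of side ~ omega_i rho around c, while i0 and all sites outside A avoid boxes
    of comparable side. With la_i = w_i rho^d these independent events have
    probabilities at most min(1, C la_i), C' la_i exp(-c la_i) and exp(-c la_i).
    Summing over A and i0 gives
      sum_{|B| = k-1} prod_{i in B} min(1, C la_i) * L_B exp(-c L_B),
    where L_B is the sum of la_i over i outside B. If B misses the heaviest site
    then L_B is at least a fraction 1/k of the total; otherwise remove the
    heaviest site and induct on k. Each of the resulting terms is summable over
    the dyadic scales, uniformly in the weights.

    The region count is not known to be measurable, but the integral of a
    nonnegative function is a supremum over simple functions below it and so is
    monotone regardless; the dominating function is a finite sum of products of
    indicators of one-variable sets, whose iterated integral is explicit. *)

Require Import Defs.
From mathcomp Require Import all_boot all_order all_algebra.
From mathcomp Require Import all_classical all_reals all_analysis.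
From mathcomp Require Import ring lra.
Set Implicit Arguments. Unset Strict Implicit. Unset Printing Implicit Defensive.
Import Order.TTheory GRing.Theory Num.Theory.
Local Open Scope classical_set_scope.
Local Open Scope ring_scope.

(** * Exponential sums over geometric scales and over subsets *)

Section ExponentialSums.
Variable R : realType.
Implicit Types (c C x y : R).

(** With M = N + 1, which is positive even for N = 0, combine 1 + x <= (1 + M / c) (1 + c x / M)
    with (1 + c x / M) ^ M <= exp (c x). *)
Lemma exprD1_expR_bounded c N : 0 < c ->
  exists2 K : R, 0 <= K & forall x, 0 <= x -> (1 + x) ^+ N * expR (- (c * x)) <= K.
Proof.
move=> c0; exists ((1 + N.+1%:R / c) ^+ N.+1) => [|x x0].
  by rewrite exprn_ge0// addr_ge0// divr_ge0// ltW.
set M : R := N.+1%:R.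
have M0 : 0 < M by rewrite ltr0n.
have e0 : 0 < 1 + c * x / M by rewrite ltr_pwDl// divr_ge0 ?mulr_ge0// ltW.
have le1 : 1 + x <= (1 + M / c) * (1 + c * x / M).
  rewrite [leRHS](_ : _ = 1 + x + (M / c + c * x / M)); last first.
    by field; rewrite ?gt_eqF.
  by rewrite lerDl addr_ge0// divr_ge0 ?mulr_ge0// ltW.
have le2 : (1 + c * x / M) ^+ N.+1 <= expR (c * x).
  have {2}-> : c * x = c * x / M * M by rewrite divfK ?gt_eqF.
  rewrite expRM_natr.
  by rewrite lerXn2r ?nnegrE ?expR_ge0 ?expR_ge1Dx// ltW.
rewrite expRN ler_pdivrMr ?expR_gt0//.
apply: (@le_trans _ _ ((1 + x) ^+ N.+1)).
  by rewrite exprS ler_peMl ?exprn_ge0 ?addr_ge0// lerDl.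
apply: (@le_trans _ _ (((1 + M / c) * (1 + c * x / M)) ^+ N.+1)).
  have Mc0 : 0 <= 1 + M / c by rewrite addr_ge0// divr_ge0// ltW.
  have ec0 := ltW e0.
  by rewrite lerXn2r// nnegrE ?addr_ge0// mulr_ge0.
by rewrite exprMn ler_wpM2l// exprn_ge0// addr_ge0// divr_ge0// ltW.
Qed.

(* The summand is dominated by a multiple of x / ((1 + x) (1 + 2 x)), which
   telescopes along x, 2 x, 4 x, ... *)
Lemma geometric_gamma_sum_bounded c (tau : R) m : 0 < c -> 2 <= tau ->
  exists2 K : R, 0 <= K & forall y J, 0 <= y ->
    \sum_(j < J) (tau ^+ j * y) ^+ m.+1 * expR (- (c * (tau ^+ j * y))) <= K.
Proof.
move=> c0 tau2; have [K K0 HK] := exprD1_expR_bounded m.+2 c0.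
exists (2 * K) => [|y J y0]; first by rewrite mulr_ge0.
have step x : 0 <= x -> x ^+ m.+1 * expR (- (c * x)) <=
    2 * K * ((1 + x)^-1 - (1 + tau * x)^-1).
  move=> x0.
  have tx : 2 * x <= tau * x by rewrite ler_wpM2r.
  have x1 : 0 < 1 + x by lra.
  have x2 : 0 < 1 + 2 * x by lra.
  apply: (@le_trans _ _ (2 * K * ((1 + x)^-1 - (1 + 2 * x)^-1))); last first.
    by rewrite ler_wpM2l ?mulr_ge0// lerD2l lerN2 lef_pV2 ?posrE; lra.
  rewrite (_ : _ - _ = x / ((1 + x) * (1 + 2 * x))); last first.
    by field; rewrite !gt_eqF.
  rewrite mulrA ler_pdivlMr ?mulr_gt0// exprSr.
  have := HK x x0.
  set e := expR _ => HKx.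
  have e0 : 0 <= e by exact: expR_ge0.
  have xm : x ^+ m <= (1 + x) ^+ m by rewrite lerXn2r ?nnegrE// ?lerDr ltW.
  have xm0 : 0 <= x ^+ m by exact: exprn_ge0.
  apply: (@le_trans _ _ (2 * ((1 + x) ^+ m.+2 * e) * x)); last first.
    by rewrite ler_wpM2r// ler_wpM2l.
  rewrite !exprSr.
  rewrite [leLHS](_ : _ = (x ^+ m * (1 + x) * (1 + 2 * x)) * (e * x)); last by ring.
  rewrite [leRHS](_ : _ = ((1 + x) ^+ m * (1 + x) * (2 * (1 + x))) * (e * x)); last by ring.
  apply: ler_wpM2r; first exact: mulr_ge0.
  apply: ler_pM; [by rewrite mulr_ge0// ltW|exact: ltW| |lra].
  by rewrite ler_wpM2r// ltW.
have tel : \sum_(j < J) (tau ^+ j * y) ^+ m.+1 * expR (- (c * (tau ^+ j * y)))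
    <= 2 * K * ((1 + y)^-1 - (1 + tau ^+ J * y)^-1).
  elim: J => [|J IH]; first by rewrite big_ord0 expr0 mul1r subrr mulr0.
  rewrite big_ord_recr/=; apply: (le_trans (lerD IH (step _ _))).
    by rewrite mulr_ge0// exprn_ge0//; lra.
  by rewrite -mulrDr addrA subrK mulrA -exprS.
apply: (le_trans tel); rewrite -[leRHS]mulr1 ler_wpM2l ?mulr_ge0//.
have tJ : 0 <= tau ^+ J * y by rewrite mulr_ge0// exprn_ge0//; lra.
have : 0 <= (1 + tau ^+ J * y)^-1 by rewrite invr_ge0; lra.
have : (1 + y)^-1 <= 1 by rewrite invf_le1; lra.
lra.
Qed.

Lemma big_setU1_reindex (I : finType) (h : I) (Q : pred {set I}) (G : {set I} -> R) :
  \sum_(B | Q B && (h \in B)) G B =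
  \sum_(B : {set I} | Q (h |: B) && (h \notin B)) G (h |: B)%SET.
Proof.
rewrite (reindex_onto (fun B : {set I} => h |: B)%SET (fun B => B :\ h)%SET) /=; last first.
  by move=> B /andP[_ hB]; rewrite finset.setD1K.
apply: eq_bigl => B; rewrite setU11 andbT; congr (_ && _).
apply/eqP/idP => [<-|hB]; first by rewrite setD11.
by rewrite setU1K.
Qed.

(** Induction on m: a product over B is at most its sum over the choices of b in B, and pulling out
    [x b] leaves a product over an m-subset of S. *)
Lemma elementary_symmetric_le (I : finType) (S : {set I}) (x : I -> R) m :
  (forall i, 0 <= x i) ->
  \sum_(B : {set I} | (B \subset S) && (#|B| == m)) \prod_(i in B) x i
    <= (\sum_(i in S) x i) ^+ m.
Proof.
move=> x0; elim: m => [|m IH].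
  rewrite expr0 (big_pred1 finset.set0) ?big_set0// => B /=.
  by rewrite cards_eq0 andbC; case: eqP => // ->; rewrite finset.sub0set.
apply: (@le_trans _ _ (\sum_(B : {set I} | (B \subset S) && (#|B| == m.+1))
    \sum_(b in B) \prod_(i in B) x i)).
  apply: ler_sum => B /andP[_ /eqP cB].
  by rewrite sumr_const cB mulrSr lerDr mulrn_wge0// prodr_ge0.
rewrite (exchange_big_dep (mem S)) /=; last first.
  by move=> B b /andP[/fintype.subsetP BS _]; exact: BS.
rewrite exprS mulr_suml; apply: ler_sum => b bS.
rewrite big_setU1_reindex.
apply: (@le_trans _ _ (x b * \sum_(B : {set I} | (B \subset S) && (#|B| == m))
    \prod_(i in B) x i)); last by rewrite ler_wpM2l.
rewrite mulr_sumr [leRHS](bigID (fun B : {set I} => b \notin B)) /= -[leLHS]addr0.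
apply: lerD; last by apply: sumr_ge0 => B _; rewrite mulr_ge0// prodr_ge0.
rewrite le_eqVlt; apply/orP; left; apply/eqP; apply: eq_big => [B|B /andP[_ bB]].
  have [bB|] := boolP (b \notin B); rewrite ?andbF// !andbT cardsU1 bB add1n eqSS.
  by rewrite finset.subUset finset.sub1set bS.
by rewrite big_setU1.
Qed.

(** B stands for A without i0. The ambient set S is a parameter because the induction on m removes
    the heaviest site from it. *)
Definition subset_weight (I : finType) c C (m : nat) (la : I -> R) (S : {set I}) : R :=
  \sum_(B : {set I} | (B \subset S) && (#|B| == m))
    (\prod_(i in B) Num.min 1 (C * la i)) *
    ((\sum_(i in S :\: B) la i) * expR (- (c * \sum_(i in S :\: B) la i))).

(* Subsets avoiding the heaviest element h leave at least 1 / (m + 2) of the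
   total weight outside; subsets containing h are handled by removing h. *)
Lemma subset_weight_rec (I : finType) c C m (la : I -> R) (S : {set I}) (h : I) :
  0 < c -> 0 <= C -> (forall i, 0 <= la i) ->
  h \in S -> (forall i, i \in S -> la i <= la h) ->
  subset_weight c C m.+1 la S <=
    C ^+ m.+1 * ((\sum_(i in S) la i) ^+ m.+2 *
      expR (- (c / m.+2%:R * \sum_(i in S) la i))) +
    subset_weight c C m la (S :\ h).
Proof.
move=> c0 C0 la0 hS hmax.
have mn0 i : 0 <= Num.min 1 (C * la i) by rewrite le_min ler01 mulr_ge0.
rewrite {1}/subset_weight (bigID (fun B : {set I} => h \in B)) /= addrC.
apply: lerD; last first.
  rewrite big_setU1_reindex.
  rewrite /subset_weight.
  rewrite [leRHS](eq_bigl (fun B : {set I} =>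
    ((h |: B \subset S) && (#|(h |: B)%SET| == m.+1)) && (h \notin B))); last first.
    move=> B; rewrite subsetD1; have [hB|] := boolP (h \notin B); rewrite ?andbF//.
    by rewrite !andbT cardsU1 hB add1n eqSS finset.subUset finset.sub1set hS.
  apply: ler_sum => B /andP[_ hB]; rewrite big_setU1//=.
  (* The factor of h is at most 1; this is the purpose of the minimum with 1. *)
  rewrite finset.setDDl -mulrA ler_piMl ?ge_min ?lexx//.
  rewrite mulr_ge0 ?prodr_ge0// mulr_ge0 ?expR_ge0// sumr_ge0//.
set La := \sum_(i in S) la i.
have La0 : 0 <= La by rewrite sumr_ge0.
apply: (@le_trans _ _ (\sum_(B : {set I} | (B \subset S) && (#|B| == m.+1))
   (\prod_(i in B) (C * la i)) * (La * expR (- (c / m.+2%:R * La))))).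
  rewrite [leRHS](bigID (fun B : {set I} => h \in B)) /= -[leLHS]add0r.
  apply: lerD.
    apply: sumr_ge0 => B _; rewrite mulr_ge0 ?(mulr_ge0 La0) ?expR_ge0// prodr_ge0// => i _.
    by rewrite mulr_ge0.
  apply: ler_sum => B /andP[/andP[BS /eqP cB] hB].
  have split : La = \sum_(i in B) la i + \sum_(i in S :\: B) la i.
    rewrite /La (big_setID B) /=; congr (_ + _).
    by apply: eq_bigl => i; rewrite (finset.setIidPr BS).
  set Lo := \sum_(i in S :\: B) la i in split *.
  have Lo0 : 0 <= Lo by rewrite sumr_ge0.
  have hLo : la h <= Lo.
    by rewrite /Lo (bigD1 h) /= ?inE ?hB// lerDl sumr_ge0.
  (* Each of the m + 1 elements of B weighs at most [la h], hence at most [Lo], so the total is at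
     most (m + 2) [Lo]. *)
  have BLo : \sum_(i in B) la i <= m.+1%:R * Lo.
    rewrite -cB mulr_natl -sumr_const; apply: ler_sum => i iB.
    by apply: (le_trans _ hLo); apply: hmax; apply: (fintype.subsetP BS).
  apply: ler_pM => //.
  - exact: prodr_ge0.
  - by rewrite mulr_ge0 ?expR_ge0.
  - apply: ler_prod => i _; rewrite mn0/= ge_min lexx orbT//.
  apply: ler_pM; rewrite ?expR_ge0//.
    by rewrite split lerDr sumr_ge0.
  rewrite ler_expR lerN2 -mulrA ler_pM2l// mulrC ler_pdivrMr ?ltr0n//.
  by rewrite split [leRHS]mulrC -[m.+2]addn1 natrD mulrDl mul1r lerD2r.
have -> : C ^+ m.+1 * (La ^+ m.+2 * expR (- (c / m.+2%:R * La))) =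
    (C * La) ^+ m.+1 * (La * expR (- (c / m.+2%:R * La))).
  by rewrite exprMn [La ^+ m.+2]exprSr !mulrA.
rewrite -mulr_suml ler_wpM2r ?mulr_ge0 ?expR_ge0// mulr_sumr.
by apply: elementary_symmetric_le => i; rewrite mulr_ge0.
Qed.

(** Induction on m by [subset_weight_rec]. The new term involves y only through its total over S, so
    [geometric_gamma_sum_bounded] bounds it by a constant free of S and y. *)
Lemma geometric_subset_weight_bounded c C (tau : R) m : 0 < c -> 0 <= C -> 2 <= tau ->
  exists2 K : R, 0 <= K & forall (I : finType) (S : {set I}) (y : I -> R) J,
    (forall i, 0 <= y i) ->
    \sum_(j < J) subset_weight c C m (fun i => tau ^+ j * y i) S <= K.
Proof.
move=> c0 C0 tau2; elim: m => [|m [K1 K10 IH]].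
  have [K K0 HK] := geometric_gamma_sum_bounded 0 c0 tau2.
  exists K => // I S y J y0.
  have Y0 : 0 <= \sum_(i in S) y i by rewrite sumr_ge0.
  apply: le_trans (HK _ J Y0); apply: ler_sum => j _.
  rewrite /subset_weight (big_pred1 finset.set0) ?big_set0 ?mul1r.
    by rewrite finset.setD0 -mulr_sumr expr1.
  move=> B /=; rewrite cards_eq0 andbC.
  by case: eqP => // ->; rewrite finset.sub0set.
have c1 : 0 < c / m.+2%:R by rewrite divr_gt0.
have [K K0 HK] := geometric_gamma_sum_bounded m.+1 c1 tau2.
exists (C ^+ m.+1 * K + K1); first by rewrite addr_ge0// mulr_ge0// exprn_ge0.
move=> I S y J y0.
have [->|/set0Pn[h0 h0S]] := eqVneq S finset.set0.
  rewrite big1 ?addr_ge0 ?mulr_ge0 ?exprn_ge0// => j _.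
  rewrite /subset_weight big1// => B /andP[].
  by rewrite finset.subset0 => /eqP->; rewrite cards0.
(* Scaling by [tau ^+ j] preserves the order, so one h is heaviest at every scale. *)
have [h hS hmax] := arg_maxP y h0S.
apply: (@le_trans _ _ (\sum_(j < J) (C ^+ m.+1 * ((tau ^+ j * \sum_(i in S) y i) ^+ m.+2 *
      expR (- (c / m.+2%:R * (tau ^+ j * \sum_(i in S) y i)))) +
    subset_weight c C m (fun i => tau ^+ j * y i) (S :\ h)))).
  apply: ler_sum => j _.
  have tj : 0 <= tau ^+ j by rewrite exprn_ge0//; lra.
  rewrite mulr_sumr; apply: subset_weight_rec => // i; first by rewrite mulr_ge0.
  by move=> iS; rewrite ler_wpM2l//; exact: hmax.
rewrite big_split /=; apply: lerD; last exact: IH.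
rewrite -mulr_sumr; apply: ler_wpM2l; first exact: exprn_ge0.
by apply: HK; rewrite sumr_ge0.
Qed.

End ExponentialSums.

(** * Iterated integrals of sums of products of indicators *)

Section UniformExpectation.
Variable R : realType.

Lemma ge0_le_integral_lower d (T : measurableType d) (mu : {measure set T -> \bar R})
    (D : set T) (f g : T -> \bar R) :
  (forall x, D x -> 0 <= f x)%E -> (forall x, D x -> f x <= g x)%E ->
  (\int[mu]_(x in D) f x <= \int[mu]_(x in D) g x)%E.
Proof.
move=> f0 fg; have g0 x : D x -> (0 <= g x)%E.
  by move=> Dx; exact: le_trans (f0 _ Dx) (fg _ Dx).
rewrite !ge0_integralE//; apply: le_ereal_sup => _ [h hf <-]; exists h => //= x.
apply: (le_trans (hf x)); rewrite /patch; case: ifPn => //.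
by rewrite inE => /fg.
Qed.

Definition unit_points : set (nat -> R) := [set v | forall j, 0 <= v j <= 1].

Lemma unit_points_vcons x v :
  0 <= x <= 1 -> unit_points v -> unit_points (vcons x v).
Proof. by move=> x01 v01 [|j] //=; exact: v01. Qed.

Lemma unif_expect_ge0 m (f : (nat -> R) -> \bar R) :
  (forall v, unit_points v -> 0 <= f v)%E -> (0 <= unif_expect m f)%E.
Proof.
elim: m f => [|m IH] f f0 /=; first by apply: f0 => j; rewrite lexx ler01.
apply: integral_ge0 => x /=; rewrite in_itv /= => x01; apply: IH => v v01.
by apply: f0; exact: unit_points_vcons.
Qed.

Lemma le_unif_expect m (f g : (nat -> R) -> \bar R) :
  (forall v, unit_points v -> 0 <= f v)%E ->
  (forall v, unit_points v -> f v <= g v)%E ->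
  (unif_expect m f <= unif_expect m g)%E.
Proof.
elim: m f g => [|m IH] f g f0 fg /=; first by apply: fg => j; rewrite lexx ler01.
apply: ge0_le_integral_lower => x /=; rewrite in_itv /= => x01.
  by apply: unif_expect_ge0 => v v01; apply: f0; exact: unit_points_vcons.
by apply: IH => v v01; [apply: f0|apply: fg]; exact: unit_points_vcons.
Qed.

(** The probability that a uniform coordinate falls in X. *)
Definition unit_length (X : set R) : R :=
  fine (@lebesgue_measure R (X `&` `[0, 1]%classic)).

Lemma lebesgue_measure_unit : @lebesgue_measure R `[0, 1]%classic = 1%E.
Proof. by rewrite lebesgue_measure_itv /= lte_fin ltr01 oppr0 adde0. Qed.

Lemma unit_lengthE (X : set R) : measurable X ->
  @lebesgue_measure R (X `&` `[0, 1]%classic) = (unit_length X)%:E.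
Proof.
move=> mX; rewrite fineK// ge0_fin_numE ?measure_ge0//.
apply: (@le_lt_trans _ _ 1%E); last by rewrite ltry.
rewrite -lebesgue_measure_unit; apply: le_measure; rewrite ?inE//.
exact: measurableI.
Qed.

Lemma integral_sum_indic (L : finType) (P : pred L) (al : L -> R) (X : L -> set R) :
  (forall l, measurable (X l)) ->
  (\int[@lebesgue_measure R]_(x in `[0%R, 1%R]) (\sum_(l | P l) al l * \1_(X l) x)%:E =
   (\sum_(l | P l) al l * unit_length (X l))%:E)%E.
Proof.
move=> mX; set mu := @lebesgue_measure R.
have iX l : mu.-integrable `[0%R, 1%R] (fun x => (\1_(X l) x)%:E).
  apply: (@measurable_bounded_integrable _ _ _ mu (\1_(X l) : R -> R) _ (measurable_itv _)).
  - by apply: (@le_lt_trans _ _ 1%E); [rewrite -lebesgue_measure_unit|rewrite ltry].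
  - exact (@measurable_realfun.measurable_indic _ (measurableTypeR R) R
      (`[0%R, 1%R]%classic : set R) (X l) (mX l)).
  exists 1; split => // M M1 x _ /=.
  rewrite indicE; case: (x \in X l); rewrite ?normr1 ?normr0 ?ltW//.
  by apply: lt_trans M1.
transitivity (\int[mu]_(x in `[0%R, 1%R]) \sum_(l | P l) ((al l)%:E * (\1_(X l) x)%:E))%E.
  by apply: eq_integral => x _; rewrite -sumEFin; apply: eq_bigr => l _; rewrite EFinM.
rewrite integral_sum//; last by move=> l; exact: integrableZl.
rewrite -sumEFin; apply: eq_bigr => l _.
rewrite integralZl// EFinM; congr (_ * _)%E.
by rewrite integral_indic//; [exact (unit_lengthE (mX l))|exact (mX l)].
Qed.

(** Integrating out the first coordinate turns its indicator into a length. The coefficients [al]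
    are arbitrary so that the indicator at a fixed x can be absorbed into them. *)
Lemma unif_expect_sum_prod (L : finType) (P : pred L) m (al : L -> R)
    (X : L -> nat -> set R) :
  (forall l c, measurable (X l c)) ->
  (unif_expect m (fun v => (\sum_(l | P l) al l * \prod_(c < m) \1_(X l c) (v c))%:E) =
   (\sum_(l | P l) al l * \prod_(c < m) unit_length (X l c))%:E)%E.
Proof.
elim: m al X => [|m IH] al X mX /=; first by congr EFin; apply: eq_bigr => l _; rewrite !big_ord0.
transitivity (\int[@lebesgue_measure R]_(x in `[0%R, 1%R]) (\sum_(l | P l)
   (al l * \prod_(c < m) unit_length (X l c.+1)) * \1_(X l 0%N) x)%:E)%E.
  apply: eq_integral => x _.
  transitivity (unif_expect m (fun v => (\sum_(l | P l)
      (al l * \1_(X l 0%N) x) * \prod_(c < m) \1_(X l c.+1) (v c))%:E)).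
    congr unif_expect; apply/funext => v; congr EFin; apply: eq_bigr => l _.
    by rewrite big_ord_recl /= mulrA.
  rewrite (IH (fun l => al l * \1_(X l 0%N) x) (fun l c => X l c.+1))//.
  by congr EFin; apply: eq_bigr => l _; rewrite mulrAC.
rewrite integral_sum_indic//; congr EFin; apply: eq_bigr => l _.
by rewrite big_ord_recl /= -mulrA [in RHS]mulrA [X in _ * X = _]mulrC mulrA.
Qed.

Lemma big_ord_mul_prod n d (F : nat -> R) :
  \prod_(c < n * d) F c = \prod_(i < n) \prod_(j < d) F (i * d + j)%N.
Proof.
elim: n => [|n IH]; first by rewrite !big_ord0.
rewrite big_ord_recr /= -IH mulSn addnC.
rewrite -(big_mkord xpredT F) -(big_mkord xpredT F).
rewrite (big_cat_nat (n := n * d)) ?leq_addr//=; congr (_ * _).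
rewrite -{1}[(n * d)%N]add0n big_addn addKn big_mkord.
by apply: eq_bigr => j _; rewrite addnC.
Qed.

(** For nested boxes the factor of site i is the indicator of lying in the outer box but not in the
    inner one. Expanding the product over sites gives a signed sum of pure products, to which
    [unif_expect_sum_prod] applies. *)
Lemma unif_expect_sum_prod_diff (L : finType) (P : pred L) n d
    (X Y : L -> 'I_n -> 'I_d -> set R) : (0 < d)%N ->
  (forall l i j, measurable (X l i j)) -> (forall l i j, measurable (Y l i j)) ->
  (unif_expect (n * d) (fun v => (\sum_(l | P l) \prod_(i < n)
     (\prod_(j < d) \1_(X l i j) (v (i * d + j)%N) -
      \prod_(j < d) \1_(Y l i j) (v (i * d + j)%N)))%:E) =
  (\sum_(l | P l) \prod_(i < n) (\prod_(j < d) unit_length (X l i j) -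
      \prod_(j < d) unit_length (Y l i j)))%:E)%E.
Proof.
move=> d0 mX mY.
(* [e.2] collects the sites taking their X factor; every other site takes its Y factor with sign
   -1. *)
pose al (e : L * {set 'I_n}) : R := \prod_(i < n) (if i \in e.2 then 1 else -1).
(* Coordinate c belongs to site [c %/ d] and axis [c %% d]; the default [setT] is not reached for c
   < n * d. *)
pose Z (e : L * {set 'I_n}) (c : nat) : set R :=
  match insub (c %/ d)%N, insub (c %% d)%N with
  | Some i, Some j => if i \in e.2 then X e.1 i j else Y e.1 i j
  | _, _ => setT
  end.
(* F is generic because the same expansion serves for indicators before integration and for lengths
   after it. *)
have expand (F : nat -> set R -> R) :
    \sum_(l | P l) \prod_(i < n) (\prod_(j < d) F (i * d + j)%N (X l i j) -
      \prod_(j < d) F (i * d + j)%N (Y l i j)) =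
    \sum_(e | P e.1) al e * \prod_(c < n * d) F c (Z e c).
  rewrite [RHS](_ : _ = \sum_(e | P e.1 && xpredT e.2) al (e.1, e.2) *
      \prod_(c < n * d) F c (Z (e.1, e.2) c)); last first.
    by apply: eq_big => [e|[l J] _]; rewrite ?andbT.
  rewrite -(pair_big_dep P (fun _ => xpredT)
    (fun l J => al (l, J) * \prod_(c < n * d) F c (Z (l, J) c))) /=.
  apply: eq_bigr => l _; rewrite bigA_distr; apply: eq_bigr => J _.
  rewrite (big_ord_mul_prod n d (fun c => F c (Z (l, J) c))) /al -big_split /=.
  apply: eq_bigr => i _.
  have E (j : 'I_d) : Z (l, J) (i * d + j)%N = if i \in J then X l i j else Y l i j.
    by rewrite /Z /= divnMDl// modnMDl divn_small// modn_small// addn0 !valK.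
  under [in RHS]eq_bigr do rewrite E.
  by case: (i \in J); rewrite ?mul1r ?mulN1r.
rewrite (expand (fun _ A => unit_length A)).
rewrite -(unif_expect_sum_prod (fun e : L * {set 'I_n} => P e.1)) => [|e c].
  congr unif_expect; apply/funext => v; congr EFin.
  exact: (expand (fun c A => \1_A (v c))).
by rewrite /Z; case: insub => // i; case: insub => // j; case: ifP.
Qed.

Lemma unit_length_ge0 (X : set R) : 0 <= unit_length X.
Proof. by rewrite fine_ge0. Qed.

Lemma unit_lengthS (X Y : set R) : measurable X -> measurable Y ->
  X `&` `[0, 1]%classic `<=` Y -> unit_length X <= unit_length Y.
Proof.
move=> mX mY XY; rewrite -lee_fin -!unit_lengthE//.
apply: le_measure; rewrite ?inE; try exact: measurableI.
by move=> x Xx; split; [exact: XY|case: Xx].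
Qed.

Lemma unit_length_itv (a b : R) : 0 <= a -> a <= b -> b <= 1 ->
  unit_length `[a, b]%classic = b - a.
Proof.
move=> a0 ab b1; rewrite /unit_length.
have -> : `[a, b]%classic `&` `[0, 1]%classic = `[a, b]%classic :> set R.
  apply/seteqP; split => [x []//|x /=]; rewrite !in_itv /= => /andP[ax xb].
  by rewrite ax xb (le_trans a0 ax) (le_trans xb b1).
rewrite lebesgue_measure_itv /= lte_fin; case: ltP => //= ba.
by apply/esym/eqP; rewrite subr_eq0 eq_le ba ab.
Qed.

Lemma unit_lengthT : unit_length setT = 1.
Proof. by rewrite /unit_length setTI lebesgue_measure_unit. Qed.

Lemma unit_length_le1 (X : set R) : measurable X -> unit_length X <= 1.
Proof. by move=> mX; rewrite -unit_lengthT; exact: unit_lengthS. Qed.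

Lemma unit_lengthU_le (X Y : set R) : measurable X -> measurable Y ->
  unit_length (X `|` Y) <= unit_length X + unit_length Y.
Proof.
move=> mX mY; rewrite -lee_fin EFinD -!unit_lengthE//; last exact: measurableU.
rewrite setIUl; apply: measureU2; exact: measurableI.
Qed.

Lemma unit_length_itv_le (a b : R) : a <= b -> unit_length `[a, b]%classic <= b - a.
Proof.
move=> ab; rewrite -lee_fin -unit_lengthE//.
apply: (@le_trans _ _ (@lebesgue_measure R `[a, b]%classic)).
  by apply: le_measure; rewrite ?inE//; exact: measurableI.
rewrite lebesgue_measure_itv /= lte_fin; case: ltP => //= _.
by rewrite lee_fin subr_ge0.
Qed.

End UniformExpectation.

(** * One-dimensional distances, lengths of their balls, and p-norms *)

Section IntervalDistance.
Variable R : realType.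

Definition in01 (a : R) : Prop := 0 <= a <= 1.

(* Sandwiching f between the circle and the line metrics treats the torus and
   the cube at once: volumes are bounded above by the former, below by the latter. *)
Definition interval_distance (f : R -> R -> R) : Prop :=
  [/\ forall a b, in01 a -> in01 b -> circ_abs a b <= f a b <= `|a - b|,
      forall a b c, in01 a -> in01 b -> in01 c -> f a c <= f a b + f b c
    & forall c r, measurable [set a | f a c <= r]].

Lemma circ_abs_le (a c r : R) :
  (circ_abs a c <= r) = (`|a - c| <= r) || (1 - r <= `|a - c|).
Proof. by rewrite /circ_abs ge_min; congr (_ || _); rewrite !lerBlDr addrC. Qed.

Lemma norm_sub_le (a c r : R) : (`|a - c| <= r) = (c - r <= a <= c + r).
Proof. by rewrite ler_distl. Qed.

Lemma interval_distance_norm : interval_distance (fun a b => `|a - b|).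
Proof.
split=> [a b _ _|a b c _ _ _|c r]; first by rewrite lexx andbT /circ_abs ge_min lexx.
  exact: ler_distD.
rewrite (_ : [set a | _] = `[c - r, c + r]%classic)//.
by apply/seteqP; split => a /=; rewrite in_itv /= norm_sub_le.
Qed.

Lemma interval_distance_circ : interval_distance (@circ_abs R).
Proof.
split=> [a b _ _|a b c|c r]; first by rewrite lexx /circ_abs ge_min lexx.
  rewrite /in01 /circ_abs !minEle => /andP[a0 a1] /andP[b0 b1] /andP[c0 c1].
  by case: (ger0P (a - b)) => ?; case: (ger0P (b - c)) => ?;
     case: (ger0P (a - c)) => ?; repeat case: ifP => ?; lra.
rewrite (_ : [set a | _] = `[c - r, c + r]%classic `|`
    (`]-oo, c - (1 - r)]%classic `|` `[c + (1 - r), +oo[%classic)).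
  by apply: measurableU => //; exact: measurableU.
apply/seteqP; split => a /=.
  rewrite circ_abs_le norm_sub_le ler_normr !in_itv /= andbT.
  by case/or3P => h; [left|right; right|right; left]; lra.
rewrite circ_abs_le norm_sub_le ler_normr !in_itv /= andbT.
by case=> [->//|[h|h]]; apply/or3P; [apply: Or33|apply: Or32]; lra.
Qed.

Variable f : R -> R -> R.
Hypothesis fP : interval_distance f.

Let ball c r : set R := [set a | f a c <= r].

Let measurable_ball c r : measurable (ball c r).
Proof. by case: fP => _ _; exact. Qed.

Lemma interval_distance_ge0 a b : in01 a -> in01 b -> 0 <= f a b.
Proof.
move=> a01 b01; case: fP => /(_ _ _ a01 b01)/andP[h _] _ _.
apply: le_trans h; rewrite /circ_abs le_min normr_ge0 /= subr_ge0.
by move: a01 b01; rewrite /in01 norm_sub_le; lra.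
Qed.

Lemma interval_distance_le_norm a b : in01 a -> in01 b -> f a b <= `|a - b|.
Proof. by move=> a01 b01; case: fP => /(_ _ _ a01 b01)/andP[]. Qed.

Lemma interval_distance_le1 a b : in01 a -> in01 b -> f a b <= 1.
Proof.
move=> a01 b01; apply: (le_trans (interval_distance_le_norm a01 b01)).
by move: a01 b01; rewrite /in01 norm_sub_le; lra.
Qed.

Lemma interval_distance_trans a b c e : in01 a -> in01 b -> in01 c ->
  `|b - c| <= e -> f a c <= f a b + e.
Proof.
move=> a01 b01 c01 bc; case: (fP) => _ /(_ a b c a01 b01 c01) h _.
by apply: (le_trans h); rewrite lerD2l (le_trans _ bc)// interval_distance_le_norm.
Qed.

(** Besides [c - r, c + r], a ball wrapping around the circle reaches only into [0, r] and
    [1 - r, 1]: the total length is 2 r + r + r. *)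
Lemma unit_length_ball_le c r : in01 c -> 0 <= r ->
  unit_length [set a | f a c <= r] <= 4 * r.
Proof.
move=> c01 r0.
pose X := `[c - r, c + r]%classic : set R.
pose Y := `[0 : R, r]%classic : set R.
pose Z := `[1 - r, 1]%classic : set R.
have mX : measurable X by exact: measurable_itv.
have mY : measurable Y by exact: measurable_itv.
have mZ : measurable Z by exact: measurable_itv.
apply: (@le_trans _ _ (unit_length (X `|` (Y `|` Z)))).
  apply: unit_lengthS; first exact: measurable_ball.
    by apply: measurableU => //; exact: measurableU.
  move=> a [/= fa]; rewrite in_itv /= => a01.
  have : circ_abs a c <= r.
    by apply: le_trans fa; case: fP => /(_ _ _ a01 c01)/andP[].
  rewrite circ_abs_le norm_sub_le ler_normr => /or3P[h|h|h].
  - by left; rewrite /X /= in_itv.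
  - by right; right; rewrite /Z /= in_itv /=; move: c01; rewrite /in01; lra.
  - by right; left; rewrite /Y /= in_itv /=; move: c01; rewrite /in01; lra.
have hX : unit_length X <= (c + r) - (c - r) by apply: unit_length_itv_le; lra.
have hY : unit_length Y <= r - 0 by apply: unit_length_itv_le.
have hZ : unit_length Z <= 1 - (1 - r) by apply: unit_length_itv_le; lra.
have h1 := unit_lengthU_le mX (measurableU _ _ mY mZ).
have h2 := unit_lengthU_le mY mZ.
lra.
Qed.

Lemma unit_length_ball_eq1 c r : in01 c -> 1 <= r ->
  unit_length [set a | f a c <= r] = 1.
Proof.
move=> c01 r1; apply/eqP; rewrite eq_le unit_length_le1; last exact: measurable_ball.
rewrite -unit_lengthT; apply: unit_lengthS => //; first exact: measurable_ball.
by move=> a [_]; rewrite /= in_itv /= => a01; apply: le_trans r1; exact: interval_distance_le1.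
Qed.

(** The ball of f contains that of the line metric. Since r <= 1, either [c, c + r / 2] or
    [c - r / 2, c] stays inside the unit interval, according to the half containing c. *)
Lemma unit_length_ball_ge c r : in01 c -> 0 <= r <= 1 ->
  r / 2 <= unit_length [set a | f a c <= r].
Proof.
move=> c01 /andP[r0 r1].
have sub a : `|a - c| <= r -> in01 a -> f a c <= r.
  by move=> ac a01; apply: le_trans ac; exact: interval_distance_le_norm.
move: (c01); rewrite /in01 => /andP[c0 c1].
have [c2|c2] := leP c (1 / 2).
  rewrite (_ : r / 2 = c + r / 2 - c); last by ring.
  rewrite -(unit_length_itv (a := c) (b := c + r / 2)); [|lra..].
  apply: unit_lengthS => [||a [/=]]; [by []|exact: measurable_ball|].
  by rewrite !in_itv /= => h1 h2; apply: sub => //; rewrite norm_sub_le; lra.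
rewrite (_ : r / 2 = c - (c - r / 2)); last by ring.
rewrite -(unit_length_itv (a := c - r / 2) (b := c)); [|lra..].
apply: unit_lengthS => [||a [/=]]; [by []|exact: measurable_ball|].
by rewrite !in_itv /= => h1 h2; apply: sub => //; rewrite norm_sub_le; lra.
Qed.

Lemma prod_ball_le d (c : 'I_d -> R) r : (forall j, in01 (c j)) -> 0 <= r ->
  \prod_(j < d) unit_length [set a | f a (c j) <= r] <= (4 * r) ^+ d.
Proof.
move=> c01 r0; rewrite -[X in _ ^+ X]card_ord -prodr_const; apply: ler_prod => j _.
by rewrite unit_length_ge0 unit_length_ball_le.
Qed.

(** For r < 1 use 1 - t <= exp (- t) with t = (r / 2) ^ d; for larger r the product equals 1. *)
Lemma prod_ball_compl_le d (c : 'I_d -> R) r : (forall j, in01 (c j)) -> 0 <= r ->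
  1 - \prod_(j < d) unit_length [set a | f a (c j) <= r] <= expR (- (r / 2) ^+ d).
Proof.
move=> c01 r0; have [r1|r1] := leP 1 r.
  by rewrite big1 ?subrr ?expR_ge0// => j _; exact: unit_length_ball_eq1.
apply: (@le_trans _ _ (1 - (r / 2) ^+ d)); last exact: expR_ge1Dx.
rewrite lerD2l lerN2 -[X in _ ^+ X]card_ord -prodr_const; apply: ler_prod => j _.
by rewrite divr_ge0//= unit_length_ball_ge// r0 ltW.
Qed.

Lemma pdist_ge p d (x y : 'I_d -> R) j : (forall q, p = Some q -> (0 < q)%N) ->
  (forall j, in01 (x j)) -> (forall j, in01 (y j)) -> f (x j) (y j) <= pdist p f x y.
Proof.
move=> pq x01 y01; have f0 i : 0 <= f (x i) (y i) by exact: interval_distance_ge0.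
case: p pq => [q|_] /=; last exact: (le_bigmax _ (fun i => f (x i) (y i))).
move=> /(_ q erefl) q0.
have q0' : q%:R != 0 :> R by rewrite pnatr_eq0 -lt0n.
have -> : f (x j) (y j) = (f (x j) (y j) ^+ q) `^ q%:R^-1.
  by rewrite -powR_mulrn// -powRrM divff// powRr1.
apply: ge0_ler_powR; rewrite ?nnegrE ?invr_ge0 ?ler0n ?exprn_ge0//.
  by apply: sumr_ge0 => i _; exact: exprn_ge0.
by rewrite (bigD1 j) //= lerDl; apply: sumr_ge0 => i _; exact: exprn_ge0.
Qed.

(** Together with [pdist_ge] this compares every p-norm with the max-norm up to the factor d, so
    that boxes can replace balls. It rests on d m ^ q <= (d m) ^ q for q >= 1. *)
Lemma pdist_le p d (x y : 'I_d -> R) (m : R) : (0 < d)%N ->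
  (forall q, p = Some q -> (0 < q)%N) ->
  (forall j, in01 (x j)) -> (forall j, in01 (y j)) ->
  0 <= m -> (forall j, f (x j) (y j) <= m) -> pdist p f x y <= d%:R * m.
Proof.
move=> d0 pq x01 y01 m0 fm; have f0 i : 0 <= f (x i) (y i) by exact: interval_distance_ge0.
have d1 : 1 <= d%:R :> R by rewrite ler1n.
have dm0 : 0 <= d%:R * m by rewrite mulr_ge0.
case: p pq => [q|_] /=; last first.
  by apply: bigmax_le => // i _; apply: (le_trans (fm i)); rewrite ler_peMl.
move=> /(_ q erefl) q0.
have q0' : q%:R != 0 :> R by rewrite pnatr_eq0 -lt0n.
have -> : d%:R * m = ((d%:R * m) ^+ q) `^ q%:R^-1.
  by rewrite -powR_mulrn// -powRrM divff// powRr1.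
apply: ge0_ler_powR; rewrite ?nnegrE ?invr_ge0 ?ler0n ?exprn_ge0//.
  by apply: sumr_ge0 => i _; exact: exprn_ge0.
apply: (@le_trans _ _ (\sum_(i < d) m ^+ q)).
  by apply: ler_sum => i _; rewrite lerXn2r ?nnegrE.
rewrite sumr_const card_ord -[leLHS]mulr_natl exprMn ler_wpM2r ?exprn_ge0//.
by rewrite -[leLHS]expr1 ler_weXn2l.
Qed.

End IntervalDistance.

(** * Grid cells, dyadic levels, and the patterns that cover all regions *)

Section Covering.
Variables (R : realType) (f : R -> R -> R) (p : option nat) (n d M : nat).
Hypothesis fP : interval_distance f.
Hypothesis d_gt0 : (0 < d)%N.
Hypothesis p_gt0 : forall q, p = Some q -> (0 < q)%N.
Hypothesis M_gt0 : (0 < M)%N.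
Variable om : 'I_n -> R.
Hypothesis om_ge1 : forall i, 1 <= om i.

(** The lower corner of the cell with index q. *)
Definition grid_point (q : {ffun 'I_d -> 'I_M}) (j : 'I_d) : R := (q j)%:R / M%:R.

(* At level l the radius r of a region satisfies r <= 2 ^ l * 2 d / M and, if
   0 < l, also 2 ^ (l - 1) * 2 d / M < r; at level 0 the inner ball is empty. *)
Definition outer_radius (l : nat) : R := 3 * d%:R * 2 ^+ l / M%:R.
Definition inner_radius (l : nat) : R :=
  if l is l'.+1 then 2 ^+ l' / M%:R else -1.

Let M_gt0R : 0 < M%:R :> R. Proof. by rewrite ltr0n. Qed.
Let d_ge1R : 1 <= d%:R :> R. Proof. by rewrite ler1n. Qed.

Lemma grid_point_in01 q j : in01 (grid_point q j).
Proof.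
rewrite /in01 /grid_point divr_ge0//= ler_pdivrMr// mul1r ler_nat.
exact/ltnW/ltn_ord.
Qed.

Lemma grid_point_near (x : 'I_d -> R) : (forall j, in01 (x j)) ->
  exists q, forall j, `|x j - grid_point q j| <= M%:R^-1.
Proof.
move=> x01.
have M1 : (M.-1 < M)%N by rewrite prednK.
have H (a : R) : in01 a -> exists k : 'I_M, `|a - k%:R / M%:R| <= M%:R^-1.
  rewrite /in01 => /andP[a0 a1].
  have aM0 : 0 <= a * M%:R by rewrite mulr_ge0// ltW.
  have /andP[t1 t2] := truncn_itv aM0; set t := Num.trunc _ in t1 t2.
  suff [k k1 k2] : exists2 k : 'I_M, k%:R <= a * M%:R & a * M%:R <= k%:R + 1.
    exists k; have e : a - k%:R / M%:R = (a * M%:R - k%:R) / M%:R.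
      by rewrite mulrBl mulfK ?gt_eqF.
    rewrite e ger0_norm ?divr_ge0 ?subr_ge0// -[leRHS]mul1r ler_pM2r ?invr_gt0//.
    by rewrite lerBlDl.
  have [tM|tM] := ltnP t M.
    by exists (Ordinal tM) => //=; rewrite natr1 ltW.
  (* Here a = 1: the right endpoint is assigned to the last cell. *)
  exists (Ordinal M1) => /=.
    by apply: le_trans t1; rewrite ler_nat (leq_trans (leq_pred _)).
  by rewrite natr1 prednK// ler_piMl// ltW.
have /choice[q qP] : forall j, exists k : 'I_M, `|x j - k%:R / M%:R| <= M%:R^-1.
  by move=> j; exact: H.
by exists [ffun j => q j] => j; rewrite /grid_point ffunE.
Qed.

(** Take the least level whose bound reaches r; level M always does since M <= 2 ^ M. This allows
    more levels than the logarithm of M, which is harmless because the sum over scales is bounded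
    uniformly in their number. *)
Lemma level_exists (r : R) : 0 <= r <= d%:R ->
  exists l : 'I_M.+1, r <= 2 ^+ l * (2 * d%:R / M%:R) /\
    (forall l', l = l'.+1 :> nat -> 2 ^+ l' * (2 * d%:R / M%:R) < r).
Proof.
move=> /andP[r0 rd].
pose Q l := r <= 2 ^+ l * (2 * d%:R / M%:R).
have QM : Q M.
  rewrite /Q (le_trans rd)// [leRHS](_ : _ = d%:R * (2 * 2 ^+ M / M%:R)); last by ring.
  rewrite ler_peMr// ler_pdivlMr// mul1r.
  have : (M <= 2 ^ M)%N by rewrite ltnW// ltn_expl.
  rewrite -(ler_nat R) natrX => h.
  have : 0 <= 2 ^+ M :> R by rewrite exprn_ge0.
  lra.
have exQ : exists l, Q l by exists M.
case: (ex_minnP exQ) => l Ql lmin.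
have lM : (l < M.+1)%N by rewrite ltnS lmin.
exists (Ordinal lM); split=> //= l' ll'.
by rewrite ltNge; apply/negP => /lmin; rewrite ll' ltnn.
Qed.

Lemma region_level (dom : set ('I_d -> R)) (s : 'I_n -> 'I_d -> R) (A : {set 'I_n}) :
  dom `<=` @cube_points R d -> (forall i j, in01 (s i j)) -> (0 < #|A|)%N ->
  region_nonempty (pdist p f) dom s om A ->
  exists q : {ffun 'I_d -> 'I_M}, exists l : 'I_M.+1, exists i0 : 'I_n,
    [/\ i0 \in A,
        forall i j, i \in A -> f (s i j) (grid_point q j) <= om i * outer_radius l
      & forall i, (i \notin A) || (i == i0) ->
          exists j, om i * inner_radius l < f (s i j) (grid_point q j)].
Proof.
move=> domS s01 /card_gt0P[i1 i1A] [x [/domS cx [r [rA rnA]]]].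
have x01 j : in01 (x j) by exact: cx.
have om0 i : 0 < om i by apply: lt_le_trans (om_ge1 i).
pose D i := pdist p f (s i) x / om i.
have [i0 i0A i0max] := arg_maxP D i1A; set r0 := D i0 in i0max.
have Dr i : i \in A -> D i <= r by move=> iA; rewrite /D ler_pdivrMr// mulrC rA.
(* Sites outside A lie beyond the radius r >= [r0], while i0 attains [r0]. *)
have near_r0 i : (i \notin A) || (i == i0) -> om i * r0 <= pdist p f (s i) x.
  case/orP => [iA|/eqP->]; last by rewrite /r0 /D mulrC divfK ?gt_eqF.
  by apply/ltW; apply: le_lt_trans (rnA _ iA); rewrite ler_pM2l// Dr.
have r0d : 0 <= r0 <= d%:R.
  have Dd : pdist p f (s i0) x <= d%:R * 1.
    by apply: pdist_le => // j; exact: interval_distance_le1.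
  have j0 : 'I_d by exact: Ordinal d_gt0.
  have D0 : 0 <= pdist p f (s i0) x.
    apply: le_trans (pdist_ge fP j0 p_gt0 (s01 i0) x01).
    exact: interval_distance_ge0.
  rewrite /r0 /D divr_ge0 ?(ltW (om0 _))//= ler_pdivrMr//.
  by apply: (le_trans Dd); rewrite ler_wpM2l.
have [q qP] := grid_point_near x01.
have [l [rl lr]] := level_exists r0d.
exists q, l, i0; split=> // [i j iA|i iP].
  apply: (@le_trans _ _ (f (s i j) (x j) + M%:R^-1)).
    by apply: interval_distance_trans => //; exact: grid_point_in01.
  have h1 : f (s i j) (x j) <= om i * r0.
    apply: (le_trans (pdist_ge fP j p_gt0 (s01 i) x01)).
    have Di : D i <= r0 by exact: i0max.
    by rewrite mulrC -ler_pdivrMr.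
  (* Minimum weight 1 enters here: the shift 1 / M from x to the corner is absorbed into a multiple
     of [om i]. *)
  have h2 : M%:R^-1 <= om i * M%:R^-1 by rewrite ler_peMl// invr_ge0 ltW.
  apply: (le_trans (lerD h1 h2)); rewrite -mulrDr ler_wpM2l ?(ltW (om0 _))//.
  apply: (le_trans (lerD rl (lexx _))); rewrite /outer_radius.
  (* The factor 3 d of [outer_radius] is 2 d for the radius plus d to cover the shift. *)
  rewrite [leRHS](_ : _ = 2 ^+ l * (2 * d%:R / M%:R) + (2 ^+ l * d%:R) * M%:R^-1); last by ring.
  rewrite lerD2l ler_peMl ?invr_ge0 ?(ltW M_gt0R)//.
  by rewrite mulr_ege1// exprn_ege1// ler1n.
have [//|noj] := pselect (exists j, om i * inner_radius l < f (s i j) (grid_point q j)).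
have allj j : f (s i j) (grid_point q j) <= om i * inner_radius l.
  by rewrite leNgt; apply/negP => h; apply: noj; exists j.
(* If all coordinates were within the inner radius, the weighted distance from site i to x would
   fall below [r0]. At level 0 the inner radius is -1 and distances are nonnegative. *)
exfalso; move: (near_r0 _ iP) lr allj; rewrite /inner_radius.
case: (nat_of_ord l) => [|l'] near lr allj.
  have := allj (Ordinal d_gt0); rewrite leNgt => /negP; apply.
  apply: (@lt_le_trans _ _ 0); first by rewrite mulrN1 oppr_lt0.
  by apply: interval_distance_ge0 => //; exact: grid_point_in01.
have {}lr := lr l' erefl.
have le_x j : f (s i j) (x j) <= om i * (2 ^+ l' * 2 / M%:R).
  apply: (@le_trans _ _ (f (s i j) (grid_point q j) + M%:R^-1)).
    by apply: interval_distance_trans => //; [exact: grid_point_in01|rewrite distrC].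
  have h2 : M%:R^-1 <= om i * (2 ^+ l' * M%:R^-1).
    rewrite mulrA ler_peMl ?invr_ge0 ?(ltW M_gt0R)//.
    by rewrite mulr_ege1// exprn_ege1// ler1n.
  apply: (le_trans (lerD (allj j) h2)).
  by rewrite le_eqVlt; apply/orP; left; apply/eqP; ring.
have Dle : pdist p f (s i) x <= d%:R * (om i * (2 ^+ l' * 2 / M%:R)).
  apply: pdist_le => //.
  by rewrite mulr_ge0 ?(ltW (om0 _))// divr_ge0 ?(ltW M_gt0R)// mulr_ge0// exprn_ge0.
have : om i * r0 <= om i * (2 ^+ l' * (2 * d%:R / M%:R)).
  apply: (le_trans near); apply: (le_trans Dle).
  by rewrite le_eqVlt; apply/orP; left; apply/eqP; ring.
by rewrite ler_pM2l// leNgt lr.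
Qed.

Lemma inner_radius_le_outer l : inner_radius l <= outer_radius l.
Proof.
rewrite /inner_radius /outer_radius; case: l => [|l].
  apply: (@le_trans _ _ 0); first by rewrite oppr_le0.
  by rewrite divr_ge0// ?mulr_ge0.
rewrite ler_pM2r ?invr_gt0// exprS mulrA ler_peMl ?exprn_ge0//.
by have := d_ge1R; lra.
Qed.

(** The components of a pattern e are the set A ([e.1]), the cell ([e.2.1.1]), the level ([e.2.1.2])
    and the site i0 attaining the radius ([e.2.2]). *)
Definition pattern : finType :=
  ({set 'I_n} * ({ffun 'I_d -> 'I_M} * 'I_M.+1 * 'I_n))%type.

Definition admissible_pattern k (e : pattern) := (#|e.1| == k) && (e.2.2 \in e.1).

Definition outer_set (e : pattern) (i : 'I_n) (j : 'I_d) : set R :=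
  if i \in e.1 then [set a | f a (grid_point e.2.1.1 j) <= om i * outer_radius e.2.1.2]
  else setT.

(** Sites of A other than i0 have nothing to avoid, hence the empty set. Likewise [outer_set] is
    everything for sites outside A. *)
Definition inner_set (e : pattern) (i : 'I_n) (j : 'I_d) : set R :=
  if (i \in e.1) && (i != e.2.2) then set0
  else [set a | f a (grid_point e.2.1.1 j) <= om i * inner_radius e.2.1.2].

Lemma measurable_outer_set e i j : measurable (outer_set e i j).
Proof. by rewrite /outer_set; case: ifP => // _; case: fP => _ _; exact. Qed.

Lemma measurable_inner_set e i j : measurable (inner_set e i j).
Proof. by rewrite /inner_set; case: ifP => // _; case: fP => _ _; exact. Qed.

Lemma inner_set_sub e i j : inner_set e i j `<=` outer_set e i j.
Proof.
rewrite /inner_set /outer_set; case: (i \in e.1) => //=; case: (i != _) => //= a /=.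
move=> h; apply: (le_trans h); rewrite ler_wpM2l ?inner_radius_le_outer//.
exact: le_trans (om_ge1 i).
Qed.

(** By [region_level] each non-empty region A has a pattern whose term equals 1; all other terms are
    nonnegative since inner sets lie in outer sets. *)
Lemma num_regions_le k (dom : set ('I_d -> R)) v : (0 < k)%N ->
  dom `<=` @cube_points R d -> unit_points v ->
  (num_regions k (pdist p f) dom (@sites_of R n d v) om)%:R <=
    \sum_(e | admissible_pattern k e) \prod_(i < n)
     (\prod_(j < d) \1_(outer_set e i j) (v (i * d + j)%N) -
      \prod_(j < d) \1_(inner_set e i j) (v (i * d + j)%N)) :> R.
Proof.
move=> k0 domS v01.
pose F (e : pattern) : R := \prod_(i < n)
  (\prod_(j < d) \1_(outer_set e i j) (v (i * d + j)%N) -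
   \prod_(j < d) \1_(inner_set e i j) (v (i * d + j)%N)).
rewrite -[leRHS]/(\sum_(e | admissible_pattern k e) F e).
have F0 e : 0 <= F e.
  apply: prodr_ge0 => i _; rewrite subr_ge0; apply: ler_prod => j _.
  rewrite !indicE ler0n ler_nat; case: (boolP (_ \in inner_set _ _ _)) => //=.
  by rewrite inE => /inner_set_sub h; rewrite mem_set.
rewrite /num_regions natr_sum.
rewrite (eq_bigl (fun e : pattern => (#|e.1| == k) && (e.2.2 \in e.1)))//.
rewrite (eq_bigr (fun e => F (e.1, e.2))); last by case.
rewrite -(pair_big_dep (fun A : {set 'I_n} => #|A| == k)
   (fun A (t : ({ffun 'I_d -> 'I_M} * 'I_M.+1 * 'I_n)%type) => t.2 \in A)
   (fun A t => F (A, t))) /=.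
apply: ler_sum => A /eqP cA.
have S0 (Q : pred _) : 0 <= \sum_(t | Q t) F (A, t) by exact: sumr_ge0.
case: asboolP => [reg|_]; last exact: S0.
have s01 i j : in01 (@sites_of R n d v i j) by exact: v01.
have A0 : (0 < #|A|)%N by rewrite cA.
have [q [l [i0 [i0A big small]]]] := region_level domS s01 A0 reg.
rewrite (bigD1 (q, l, i0)) //=.
suff -> : F (A, (q, l, i0)) = 1 by rewrite lerDl.
rewrite /F big1// => i _; rewrite big1 => [|j _]; last first.
  rewrite indicE mem_set// /outer_set /=; case: ifP => // iA.
  exact: (big i j iA).
suff [j hj] : exists j : 'I_d, v (i * d + j)%N \notin inner_set (A, (q, l, i0)) i j.
  have h0 : \1_(inner_set (A, (q, l, i0)) i j) (v (i * d + j)%N) = 0 :> R.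
    by rewrite indicE (negbTE hj).
  by rewrite (bigD1 j) //= h0 mul0r subr0.
have [iA|iA] := boolP ((i \in A) && (i != i0)).
  by exists (Ordinal d_gt0); rewrite /inner_set /= iA notin_setE.
have [j hj] : exists j, om i * inner_radius l < f (sites_of v i j) (grid_point q j).
  by apply: small; rewrite negb_and negbK in iA.
exists j; rewrite /inner_set /= (negbTE iA) notin_setE /=.
by apply/negP; rewrite -ltNge.
Qed.

End Covering.

(** * Summation of pattern weights over A and i0 *)

Section PatternSums.
Variables (R : realType) (I : finType) (c C C' : R) (la : I -> R).

Definition pattern_weight (A : {set I}) (i0 i : I) : R :=
  if i \in A then
    if i == i0 then C' * (la i * expR (- (c * la i))) else Num.min 1 (C * la i)
  else expR (- (c * la i)).

(** Put B = A minus i0. The exponential factor of i0 joins those of the sites outside A, so i0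
    contributes only [C' * la i0] beyond a product depending on B alone; summing over i0 outside B
    gives the total weight there. *)
Lemma sum_pattern_weight k :
  \sum_(A : {set I} | #|A| == k.+1) \sum_(i0 in A) \prod_i pattern_weight A i0 i =
  C' * subset_weight c C k la [set: I]%SET.
Proof.
rewrite (exchange_big_dep xpredT) //=.
under eq_bigr do rewrite big_setU1_reindex.
rewrite (exchange_big_dep (fun B : {set I} => #|B| == k)) /=; last first.
  by move=> i0 B _ /andP[]; rewrite cardsU1 => /[swap] ->.
rewrite /subset_weight mulr_sumr; apply: eq_big => [B|B /eqP cB].
  by rewrite finset.subsetT.
rewrite (eq_bigl (fun i0 => i0 \in [set: I] :\: B)); last first.
  move=> i0; rewrite !inE andbT; case: (boolP (i0 \notin B)); rewrite ?andbF// => iB.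
  by rewrite cardsU1 iB cB eqxx.
pose G := \prod_i (if i \in B then Num.min 1 (C * la i) else expR (- (c * la i))).
have GE : G = (\prod_(i in B) Num.min 1 (C * la i)) *
    expR (- (c * \sum_(i in [set: I] :\: B) la i)).
  rewrite /G (bigID (mem B)) /=; congr (_ * _).
    by apply: eq_bigr => i ->.
  rewrite mulr_sumr -sumrN expR_sum; apply: eq_big => [i|i /negbTE->//].
  by rewrite !inE andbT.
transitivity (\sum_(i0 in [set: I] :\: B) C' * la i0 * G); last first.
  by rewrite -mulr_suml -mulr_sumr GE; ring.
apply: eq_bigr => i0; rewrite !inE andbT => iB.
rewrite /G (bigD1 i0) //= [in RHS](bigD1 i0) //= (negbTE iB).
rewrite {1}/pattern_weight setU11 eqxx.
rewrite (eq_bigr (fun i => if i \in B then Num.min 1 (C * la i) else expR (- (c * la i)))).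
  by ring.
by move=> i /negbTE ii0; rewrite /pattern_weight !inE ii0.
Qed.

End PatternSums.

(** * Probability that random sites match a pattern *)

Section PatternProbability.
Variables (R : realType) (f : R -> R -> R) (n d M : nat).
Hypothesis fP : interval_distance f.
Hypothesis d_gt0 : (0 < d)%N.
Hypothesis M_gt0 : (0 < M)%N.
Variable w : 'I_n -> R.
Hypothesis w_ge1 : forall i, 1 <= w i.

Let c : R := 2^-1 ^+ d.
(** 24 d is 4 (length of a ball per radius) times 3 d (from [outer_radius]) times 2, as weights at
    level l + 1 are measured at scale 2 ^ l. *)
Let C : R := (24 * d%:R) ^+ d.
Let om := omega d w.

Let M_gt0R : 0 < M%:R :> R. Proof. by rewrite ltr0n. Qed.

Let C_ge1 : 1 <= C.
Proof. by rewrite exprn_ege1// -natrM ler1n muln_gt0. Qed.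

Lemma omega_ge1 i : 1 <= om i.
Proof.
rewrite [leLHS](_ : _ = 1 `^ d%:R^-1); last by rewrite powR1.
by apply: ge0_ler_powR; rewrite ?nnegrE ?invr_ge0 ?ler0n//;
  exact: le_trans (w_ge1 i).
Qed.

Lemma omegaX i : om i ^+ d = w i.
Proof.
rewrite /om /omega -powR_mulrn ?powR_ge0// -powRrM mulVf ?powRr1//.
  exact: le_trans (w_ge1 i).
by rewrite pnatr_eq0 -lt0n.
Qed.

Let om_ge0 i : 0 <= om i. Proof. exact: le_trans (omega_ge1 i). Qed.

Definition site_prob (e : pattern n d M) (i : 'I_n) : R :=
  \prod_(j < d) unit_length (outer_set f om e i j) -
  \prod_(j < d) unit_length (inner_set f om e i j).

Lemma site_prob_ge0 e i : 0 <= site_prob e i.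
Proof.
rewrite subr_ge0; apply: ler_prod => j _; rewrite unit_length_ge0 /=.
apply: unit_lengthS; [exact: measurable_inner_set|exact: measurable_outer_set|].
move=> a [+ _]; apply: inner_set_sub => //; exact: omega_ge1.
Qed.

Let prod_ge0 (X : 'I_d -> set R) : 0 <= \prod_(j < d) unit_length (X j).
Proof. by apply: prodr_ge0 => j _; exact: unit_length_ge0. Qed.

Let site_prob_le_outer e i : site_prob e i <= \prod_(j < d) unit_length (outer_set f om e i j).
Proof. by rewrite lerBlDr lerDl. Qed.

Let site_prob_le1 e i : site_prob e i <= 1.
Proof.
apply: (le_trans (site_prob_le_outer e i)); apply: prodr_ile1 => j _.
by rewrite unit_length_ge0 unit_length_le1//; exact: measurable_outer_set.
Qed.

Let site_prob_le_pow (e : pattern n d M) i : i \in e.1 ->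
  site_prob e i <= (4 * (om i * outer_radius _ d M e.2.1.2)) ^+ d.
Proof.
move=> iA; apply: (le_trans (site_prob_le_outer e i)).
under eq_bigr do rewrite /outer_set iA.
apply: prod_ball_le => // [j|]; first exact: grid_point_in01.
by rewrite mulr_ge0// divr_ge0// !mulr_ge0.
Qed.

Let site_prob_le_exp (e : pattern n d M) i l : e.2.1.2 = l.+1 :> nat ->
  (i \notin e.1) || (i == e.2.2) ->
  site_prob e i <= expR (- (om i * (2 ^+ l / M%:R) / 2) ^+ d).
Proof.
move=> el iP.
apply: (@le_trans _ _ (1 - \prod_(j < d) unit_length (inner_set f om e i j))).
  rewrite lerD2r; apply: prodr_ile1 => j _.
  by rewrite unit_length_ge0 unit_length_le1//; exact: measurable_outer_set.
under eq_bigr do rewrite /inner_set -[_ && _]negbK negb_and negbK iP /= el.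
apply: prod_ball_compl_le => // [j|]; first exact: grid_point_in01.
by rewrite mulr_ge0// divr_ge0// exprn_ge0.
Qed.

(** With no inner ball there is no exponential decay, so only the outer boxes of the sites in A are
    used. *)
Lemma prod_site_prob_level0 (e : pattern n d M) : e.2.1.2 = 0%N :> nat ->
  \prod_i site_prob e i <= \prod_(i in e.1) (C * (w i / M%:R ^+ d)).
Proof.
move=> e0; rewrite [leRHS]big_mkcond /=; apply: ler_prod => i _.
rewrite site_prob_ge0 /=; case: ifP => [iA|_]; last exact: site_prob_le1.
apply: (le_trans (site_prob_le_pow iA)).
rewrite -omegaX -expr_div_n /C -exprMn /outer_radius e0 expr0.
have h0 : 0 <= om i / M%:R by rewrite divr_ge0.
have h1 : 0 <= d%:R * (om i / M%:R) by rewrite mulr_ge0.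
rewrite lerXn2r ?nnegrE//.
- by rewrite mulr_ge0// mulr_ge0// divr_ge0// !mulr_ge0.
- by rewrite -mulrA mulr_ge0.
rewrite [leLHS](_ : _ = 12 * (d%:R * (om i / M%:R))); last by ring.
by rewrite -mulrA; lra.
Qed.

Lemma prod_site_prob_levelS (e : pattern n d M) l : e.2.1.2 = l.+1 :> nat ->
  \prod_i site_prob e i <= \prod_i pattern_weight c C (C * expR c)
     (fun i => (2 ^+ d) ^+ l * (w i / M%:R ^+ d)) e.1 e.2.2 i.
Proof.
move=> el; apply: ler_prod => i _; rewrite site_prob_ge0 /=.
set la := fun i => _.
have la0 : 0 <= la i.
  by rewrite mulr_ge0 ?exprn_ge0// divr_ge0 ?exprn_ge0// (le_trans _ (w_ge1 i)).
have laE : la i = (om i * (2 ^+ l / M%:R)) ^+ d.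
  by rewrite /la -omegaX exprMn expr_div_n -!exprM [(l * d)%N]mulnC; ring.
have c0 : 0 <= c by rewrite exprn_ge0.
have leC : i \in e.1 -> site_prob e i <= C * la i.
  move=> iA; apply: (le_trans (site_prob_le_pow iA)).
  rewrite laE /C -exprMn /outer_radius el exprS.
  rewrite [X in X ^+ d <= _](_ : _ = 24 * d%:R * (om i * (2 ^+ l / M%:R)))//.
  by ring.
have leE : (i \notin e.1) || (i == e.2.2) -> site_prob e i <= expR (- (c * la i)).
  move=> iP; apply: (le_trans (site_prob_le_exp el iP)).
  by rewrite laE /c -exprMn [_ / 2]mulrC.
rewrite /pattern_weight; have [iA|iA] := boolP (i \in e.1); last by apply: leE; rewrite iA.
have [ii|ii] := eqVneq i e.2.2; last by rewrite le_min site_prob_le1 leC.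
have CeC : 1 <= C * expR c.
  by rewrite mulr_ege1// -expR0 ler_expR.
(* For the site i0, if [la i <= 1] the bound [C * la i] suffices because exp (c - c la) >= 1;
   otherwise the exponential bound suffices because C exp c and [la i] are at least 1. *)
have [la1|la1] := leP (la i) 1.
  apply: (le_trans (leC iA)); rewrite -mulrA ler_wpM2l ?(le_trans ler01)//.
  rewrite mulrCA ler_peMr// -expRD -expR0 ler_expR subr_ge0.
  by rewrite ler_piMr.
apply: (le_trans (leE _)); first by rewrite ii eqxx orbT.
rewrite mulrA ler_peMl ?expR_ge0//.
by rewrite mulr_ege1// ltW.
Qed.

End PatternProbability.

(** * Assembling the bound on the expected number of regions *)

Section Expectation.
Variable R : realType.

Lemma unif_expect_cst1 m : unif_expect m (fun _ : nat -> R => 1%E) = 1%E.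
Proof.
elim: m => //= m IH.
rewrite (_ : (fun x => _) = cst 1%E); last by apply/funext.
by rewrite integral_cst//= mul1e; exact: lebesgue_measure_unit.
Qed.

Lemma expected_regions0_le1 n d (dist : ('I_d -> R) -> ('I_d -> R) -> R) dom (w : 'I_n -> R) :
  (expected_regions 0 dist dom w <= 1)%E.
Proof.
rewrite -(unif_expect_cst1 (n * d)); apply: le_unif_expect => v _; rewrite lee_fin//.
rewrite /num_regions (big_pred1 finset.set0) => [|A]; last by rewrite /= cards_eq0.
by rewrite lern1 leq_b1.
Qed.

(** The bound G does not depend on the cell, so the sum over cells gives the factor M ^ d. *)
Lemma sum_admissible_le n d M k (F : pattern n d M -> R)
    (G : {set 'I_n} -> nat -> 'I_n -> R) :
  (forall e, F e <= G e.1 e.2.1.2 e.2.2) ->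
  \sum_(e | admissible_pattern k e) F e <=
  (M ^ d)%:R * \sum_(l < M.+1) \sum_(A : {set 'I_n} | #|A| == k) \sum_(i in A) G A l i.
Proof.
move=> FG.
apply: (@le_trans _ _ (\sum_(e : pattern n d M | admissible_pattern k e)
    G e.1 e.2.1.2 e.2.2)); first exact: ler_sum.
rewrite -(pair_big_dep (fun A : {set 'I_n} => #|A| == k)
   (fun A (t : ({ffun 'I_d -> 'I_M} * 'I_M.+1 * 'I_n)%type) => t.2 \in A)
   (fun A t => G A t.1.2 t.2)) /=.
rewrite [X in _ * X]exchange_big mulr_sumr /=; apply: ler_sum => A _.
rewrite (eq_bigl (fun t : ({ffun 'I_d -> 'I_M} * 'I_M.+1 * 'I_n)%type =>
   xpredT t.1 && (t.2 \in A)))//.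
rewrite -(pair_big_dep xpredT (fun _ i => i \in A)
   (fun (t : ({ffun 'I_d -> 'I_M} * 'I_M.+1)%type) i => G A t.2 i)) /=.
rewrite -(pair_big xpredT xpredT
   (fun (_ : {ffun 'I_d -> 'I_M}) (l : 'I_M.+1) => \sum_(i in A) G A l i)) /=.
by rewrite sumr_const card_ffun !card_ord -[leLHS]mulr_natl.
Qed.

Lemma expected_regions_le d k (p : option nat) : (0 < d)%N -> (0 < k)%N ->
  (forall q, p = Some q -> (0 < q)%N) ->
  exists2 K : R, 0 <= K & forall (f : R -> R -> R) (dom : set ('I_d -> R)),
    interval_distance f -> dom `<=` @cube_points R d ->
    forall (n : nat) (w : 'I_n -> R), (forall i, 1 <= w i) -> (0 < n)%N ->
    (expected_regions k (pdist p f) dom w <= (K * \sum_(i < n) w i)%:E)%E.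
Proof.
move=> d0; case: k => // k _ p0.
pose c : R := 2^-1 ^+ d.
pose C : R := (24 * d%:R) ^+ d.
have c0 : 0 < c by rewrite exprn_gt0.
have C0 : 0 <= C by rewrite exprn_ge0// mulr_ge0.
have tau2 : 2 <= 2 ^+ d :> R by rewrite -[leLHS]expr1 ler_weXn2l// ler1n.
have [K K0 HK] := geometric_subset_weight_bounded k c0 C0 tau2.
have e0 : 0 <= C * expR c by rewrite mulr_ge0 ?expR_ge0.
(* At most 2 ^ d W cells; inside the bracket, level 0 and then all positive levels together. *)
exists (2 ^+ d * (k.+1%:R * C ^+ k.+1 + C * expR c * K)).
  by rewrite mulr_ge0 ?exprn_ge0// addr_ge0 ?mulr_ge0 ?exprn_ge0.
move=> f dom fP domS n w w1 n0; set W := \sum_(i < n) w i.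
have w0 i : 0 <= w i by rewrite (le_trans _ (w1 i)).
have W1 : 1 <= W.
  by rewrite /W (bigD1 (Ordinal n0)) //= (le_trans (w1 (Ordinal n0)))// lerDl sumr_ge0.
have W0 : 0 <= W by exact: le_trans W1.
pose z := W `^ d%:R^-1.
have zd : z ^+ d = W.
  by rewrite -powR_mulrn ?powR_ge0// -powRrM mulVf ?powRr1// pnatr_eq0 -lt0n.
have z1 : 1 <= z.
  rewrite [leLHS](_ : _ = 1 `^ d%:R^-1); last by rewrite powR1.
  by apply: ge0_ler_powR; rewrite ?nnegrE ?invr_ge0 ?ler0n.
have z0 : 0 <= z by exact: powR_ge0.
have /andP[t1 t2] := truncn_itv z0.
(* Since z >= 1, rounding up gives z <= M <= 2 z, hence W <= M ^ d <= 2 ^ d W. *)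
pose M := (Num.trunc z).+1.
have M0 : 0 < M%:R :> R by rewrite ltr0n.
have M0' := ltW M0.
have zM : z <= M%:R by exact: ltW.
have Mz : M%:R <= 2 * z by rewrite /M -natr1; lra.
have WM : W <= M%:R ^+ d by rewrite -zd lerXn2r.
have MW : M%:R ^+ d <= 2 ^+ d * W.
  by rewrite -zd -exprMn lerXn2r// nnegrE mulr_ge0.
have om1 i : 1 <= omega d w i by exact: omega_ge1.
apply: (@le_trans _ _ (unif_expect (n * d) (fun v =>
   (\sum_(e : pattern n d M | admissible_pattern k.+1 e) \prod_(i < n)
     (\prod_(j < d) \1_(outer_set f (omega d w) e i j) (v (i * d + j)%N) -
      \prod_(j < d) \1_(inner_set f (omega d w) e i j) (v (i * d + j)%N)))%:E))).
  apply: le_unif_expect => v v01; rewrite lee_fin ?ler0n//.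
  exact: num_regions_le.
rewrite unif_expect_sum_prod_diff//; last first.
- by move=> *; exact: measurable_inner_set.
- by move=> *; exact: measurable_outer_set.
rewrite lee_fin.
pose la l i : R := (2 ^+ d) ^+ l * (w i / M%:R ^+ d).
pose G (A : {set 'I_n}) (l : nat) (i0 : 'I_n) : R :=
  if l is l'.+1 then \prod_i pattern_weight c C (C * expR c) (la l') A i0 i
  else \prod_(i in A) (C * (w i / M%:R ^+ d)).
apply: (@le_trans _ _ ((M ^ d)%:R * \sum_(l < M.+1) \sum_(A : {set 'I_n} | #|A| == k.+1)
   \sum_(i in A) G A l i)).
  apply: sum_admissible_le => e; rewrite /G; case E : (nat_of_ord e.2.1.2) => [|l].
    exact: prod_site_prob_level0.
  exact: prod_site_prob_levelS.
have y0 i : 0 <= w i / M%:R ^+ d by rewrite divr_ge0// exprn_ge0.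
(* The choice of i0 costs k + 1, and the remaining symmetric sum is at most (C W / M ^ d) ^ (k + 1),
   where W <= M ^ d. *)
have level0 : \sum_(A : {set 'I_n} | #|A| == k.+1) \sum_(i in A) G A 0%N i
    <= k.+1%:R * C ^+ k.+1.
  rewrite (eq_bigr (fun A : {set 'I_n} => k.+1%:R * \prod_(i in A) (C * (w i / M%:R ^+ d)))).
    rewrite -mulr_sumr ler_wpM2l//.
    have h := @elementary_symmetric_le R _ [set: 'I_n]%SET (fun i => C * (w i / M%:R ^+ d)) k.+1.
    apply: (@le_trans _ _ ((\sum_(i in [set: 'I_n]%SET) C * (w i / M%:R ^+ d)) ^+ k.+1)).
      under eq_bigl => A do rewrite -[_ == _]andTb -(finset.subsetT A).
      by apply: h => i; rewrite mulr_ge0.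
    have s0 : 0 <= \sum_(i in [set: 'I_n]%SET) w i / M%:R ^+ d by rewrite sumr_ge0.
    rewrite -mulr_sumr lerXn2r ?nnegrE ?mulr_ge0// -[leRHS]mulr1 ler_wpM2l//.
    rewrite -mulr_suml ler_pdivrMr ?exprn_gt0// mul1r.
    by under eq_bigl do rewrite inE.
  by move=> A /eqP cA; rewrite /G sumr_const cA mulr_natl.
have levelS : \sum_(l < M) \sum_(A : {set 'I_n} | #|A| == k.+1) \sum_(i in A) G A l.+1 i
    <= C * expR c * K.
  under eq_bigr do rewrite sum_pattern_weight.
  by rewrite -mulr_sumr ler_wpM2l//; exact: HK.
apply: (@le_trans _ _ (M%:R ^+ d * (k.+1%:R * C ^+ k.+1 + C * expR c * K))).
  by rewrite natrX big_ord_recl ler_wpM2l ?exprn_ge0//; exact: lerD.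
by rewrite [leRHS]mulrAC ler_wpM2r// addr_ge0// mulr_ge0// exprn_ge0.
Qed.

End Expectation.

(** * Specialisation to the torus and the cube *)

Theorem mainTheorem12 (R : realType) (d k : nat) (p : option nat) :
  (0 < d)%N -> (forall q, p = Some q -> (0 < q)%N) ->
  exists C : R, 0 < C /\
    forall (n : nat) (w : 'I_n -> R),
      (forall i, 1 <= w i) -> (exists i, w i = 1) ->
      (expected_regions k (@torus_dist R p d) (@torus_points R d) w
         <= (C * \sum_(i < n) w i)%:E)%E /\
      (expected_regions k (@cube_dist R p d) (@cube_points R d) w
         <= (C * \sum_(i < n) w i)%:E)%E.
Proof.
(* For k = 0 only the empty set counts, so there is at most one region, and W >= 1. *)
move=> d0 p0; have [->|k0] := posnP k.
  exists 1; split=> // n w w1 [i0 _].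
  rewrite mul1r; have W1 : 1 <= \sum_(i < n) w i.
    rewrite (bigD1 i0)//= (le_trans (w1 i0))// lerDl sumr_ge0// => i _.
    by rewrite (le_trans _ (w1 i)).
  by split; apply: (@le_trans _ _ 1%E); rewrite ?expected_regions0_le1 ?lee_fin.
have [K K0 HK] := expected_regions_le R d0 k0 p0.
(* K may be 0; adding 1 makes the constant positive. *)
exists (K + 1); split=> [|n w w1 [i0 _]]; first by rewrite ltr_wpDl.
have n0 : (0 < n)%N by case: n i0 {w w1} => // -[].
have WK : ((K * \sum_(i < n) w i)%:E <= ((K + 1) * \sum_(i < n) w i)%:E)%E.
  rewrite lee_fin ler_wpM2r ?lerDl// sumr_ge0// => i _.
  by rewrite (le_trans _ (w1 i)).
split; apply: le_trans WK; apply: HK => //.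
- exact: interval_distance_circ.
- by move=> x x01 j; have /andP[-> /ltW] := x01 j.
- exact: interval_distance_norm.
Qed.
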